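(* Let $N$ be a finite ground set with $n=|N|$, let $f:2^N\to\mathbb{R}$ be non-negative, symmetric and submodular, accessed through a value oracle, let $\mathcal{M}=(N,\mathcal{I})$ be a matroid of rank $k$, and let $\epsilon\in(0,1)$. Consider the algorithm \textsc{Greedy-Matroid}, run on the instance augmented with dummy elements as follows: add a set $D$ of $2k$ dummy elements, replace $N$ by $N\cup D$, $f$ by $S\mapsto f(S\setminus D)$, and $\mathcal{I}$ by $\{S\subseteq N\cup D: S\setminus D\in\mathcal{I}, |S|\le k\}$ (still denoted $N,f,\mathcal{I}$). The algorithm sets $S_0$ to an arbitrary base consisting only of elements of $D$, sets $K=\lceil\frac{k}{3}\ln\epsilon^{-1}\rceil$, and for $i=1,\dots,K$: lets $M_i\subseteq N\setminus S_{i-1}$ be a base maximizing $\sum_{u\in M_i} f(u\mid S_{i-1})$; lets $g_i:M_i\to S_{i-1}$ be a one-to-one map with $g_i(u)=u$ for $u\in M_i\cap S_{i-1}$ and $S_{i-1}+u-g_i(u)\in\mathcal{I}$ for every $u\in M_i$; chooses $u_i\in\arg\max_{u\in M_i} f(S_{i-1}+u-g_i(u))-f(S_{i-1})$; sets $S_i\gets S_{i-1}+u_i-g_i(u_i)$ and then $S_i\gets\textsc{Delete}(S_i)$. It returns $S_K$. Then this algorithm has an approximation ratio of $(1-\epsilon)/3$ for $\max\{f(S):S\in\mathcal{I}\}$ and uses $O(kn\log\frac{n}{\epsilon})$ value-oracle queries.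
   Context: For $S\subseteq N$ and $u\in N$, $S+u=S\cup\{u\}$, $S-u=S\setminus\{u\}$, $\bar S=N\setminus S$, $f(u\mid S)=f(S+u)-f(S)$. $f$ is symmetric if $f(S)=f(\bar S)$ for all $S\subseteq N$; submodular if $f(S)+f(T)\ge f(S\cup T)+f(S\cap T)$ for all $S,T$. A base of a matroid is an inclusion-wise maximal independent set; the rank is the common size of bases. An approximation ratio $\alpha$ means the output is feasible and has value at least $\alpha$ times the optimum. The query complexity is the number of evaluations of $f$. The procedure \textsc{Delete}$(S)$ visits the elements $u$ of the input set $S$ one by one in arbitrary order, and for each visited $u$, if $f(u\mid S-u)<0$ for the current set $S$, it sets $S\gets S-u$; it returns the final set $S$.
   Formalization: The ratio is claimed only for rank k other than 1 and 2 (it fails at both), the query bound only for n ≥ 2 (it fails for n = k = 1 as ε→1), and a set shrunk by Delete is refilled to a base with dummies before the next iteration, since otherwise g_i need not exist. *)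

(* Defs.v *)
From HB Require Import structures.
From mathcomp Require Import all_boot all_order all_algebra.
From mathcomp Require Import reals exp.
Set Implicit Arguments.
Unset Strict Implicit.
Unset Printing Implicit Defensive.
Import Order.TTheory GRing.Theory Num.Theory.
Local Open Scope ring_scope.

Definition symmetric_setfun (R : realType) (N : finType) (f : {set N} -> R) :=
  forall S : {set N}, f S = f (~: S).

Definition submodular (R : realType) (N : finType) (f : {set N} -> R) :=
  forall S T : {set N}, f (S :|: T) + f (S :&: T) <= f S + f T.

Definition matroid (N : finType) (I : {set {set N}}) : Prop :=
  [/\ set0 \in I,
      forall A B : {set N}, B \in I -> A \subset B -> A \in I
    & forall A B : {set N}, A \in I -> B \in I -> (#|A| < #|B|)%N ->
        exists2 x, x \in B :\: A & x |: A \in I].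

Definition base (N : finType) (I : {set {set N}}) (B : {set N}) : bool :=
  maxset (fun S : {set N} => S \in I) B.

Definition matroid_rank (N : finType) (I : {set {set N}}) (k : nat) : Prop :=
  forall B : {set N}, base I B -> #|B| = k.

(* For a non-empty hereditary [I], this is max {f S : S in I}. *)
Definition opt (R : realType) (N : finType) (f : {set N} -> R)
    (I : {set {set N}}) : R :=
  f [arg max_(S > set0 | S \in I) f S]%O.

(* Adaptive, nondeterministic computations with access to a value oracle:
   [Query S c] reads the value of the objective at S and continues with it;
   [Pick P c] continues with an arbitrary object satisfying P.  A computation
   is independent of the objective except through the answers to its queries. *)
Inductive prog (R : Type) (V : finType) (A : Type) : Type :=
| Ret of A
| Query of {set V} & (R -> prog R V A)
| Pick (B : Type) of (B -> Prop) & (B -> prog R V A).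

Arguments Ret {R V A} _.
Arguments Query {R V A} _ _.
Arguments Pick {R V A B} _ _.

Fixpoint bind (R : Type) (V : finType) (A B : Type) (p : prog R V A)
    (c : A -> prog R V B) : prog R V B :=
  match p with
  | Ret a => c a
  | Query T d => Query T (fun x => bind (d x) c)
  | Pick _ P d => Pick P (fun b => bind (d b) c)
  end.

Notation "'let!' x := p 'in' q" := (bind p (fun x => q))
  (at level 200, x name, p at level 100, q at level 200).

Definition query {R : Type} {V : finType} (S : {set V}) : prog R V R :=
  Query S Ret.

Definition pick_any {R : Type} {V : finType} {B : Type} (P : B -> Prop) :
  prog R V B := Pick P Ret.

(* Against the oracle f, with q queries already made: the computation never
   reaches a choice that cannot be made, and however its choices are made, the
   total number of queries and the result satisfy Q. *)
Fixpoint every_run (R : Type) (V : finType) (A : Type) (f : {set V} -> R)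
    (p : prog R V A) (q : nat) (Q : nat -> A -> Prop) : Prop :=
  match p with
  | Ret a => Q q a
  | Query T c => every_run f (c (f T)) q.+1 Q
  | Pick _ P c =>
      (exists b, P b) /\ (forall b, P b -> every_run f (c b) q Q)
  end.

Section Algorithm.
Variables (R : realType) (V : finType).
(* the set of dummy elements and the family of feasible sets *)
Variables (D : {set V}) (I : {set {set V}}).

(* f(T) - f(S) *)
Definition gain (T S : {set V}) : prog R V R :=
  let! a := query T in let! b := query S in Ret (a - b).

Fixpoint tabulate (p : V -> prog R V R) (s : seq V) : prog R V (V -> R) :=
  if s is u :: s' then
    let! x := p u in
    let! w := tabulate p s' in
    Ret (fun v => if v == u then x else w v)
  else Ret (fun=> 0).

Fixpoint delete_loop (s : seq V) (S : {set V}) : prog R V {set V} :=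
  if s is u :: s' then
    let! x := gain (u |: (S :\ u)) (S :\ u) in
    delete_loop s' (if x < 0 then S :\ u else S)
  else Ret S.

Definition delete (S : {set V}) : prog R V {set V} :=
  let! s := pick_any (fun s : seq V => perm_eq s (enum S)) in
  delete_loop s S.

(* One iteration.  The set received from the previous iteration may have lost
   elements to [delete], so it is first completed to a base S by dummy
   elements, which leaves its value unchanged (if nothing was deleted then S is
   that set itself).  Without this no one-to-one map g : M -> S need exist. *)
Definition greedy_step (S' : {set V}) : prog R V {set V} :=
  let! S := pick_any (fun S : {set V} =>
    [/\ base I S, S' \subset S & S :\: S' \subset D]) in
  let! w := tabulate (fun u => gain (u |: S) S) (enum (~: S)) in
  let! M := pick_any (fun M : {set V} =>
    [/\ base I M, M \subset ~: S
      & forall M' : {set V}, base I M' -> M' \subset ~: S ->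
          \sum_(u in M') w u <= \sum_(u in M) w u]) in
  let! g := pick_any (fun g : V -> V =>
    [/\ {in M, forall u, g u \in S}, {in M &, injective g},
        {in M :&: S, forall u, g u = u}
      & {in M, forall u, (u |: S) :\ g u \in I}]) in
  let! v := tabulate (fun u => gain ((u |: S) :\ g u) S) (enum M) in
  let! u := pick_any (fun u : V => u \in M /\ {in M, forall u', v u' <= v u}) in
  delete ((u |: S) :\ g u).

Fixpoint greedy_iter (K : nat) (S : {set V}) : prog R V {set V} :=
  if K is K'.+1 then let! S' := greedy_step S in greedy_iter K' S' else Ret S.

Definition greedy_matroid (k : nat) (eps : R) : prog R V {set V} :=
  let! S0 := pick_any (fun S : {set V} => base I S /\ S \subset D) in
  greedy_iter `|Num.ceil (k%:R / 3 * ln eps^-1)|%N S0.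

End Algorithm.

(* The augmented ground set is the disjoint union of N and 2k dummies. *)
Definition aug (N : finType) (k : nat) : finType := (N + 'I_(2 * k))%type.

Section Augmentation.
Variables (R : realType) (N : finType) (k : nat).

Definition dummies : {set aug N k} := [set inr d | d : 'I_(2 * k)].

(* S :\: dummies, as a subset of the original ground set *)
Definition orig (S : {set aug N k}) : {set N} := [set u | inl u \in S].

Definition aug_fun (f : {set N} -> R) (S : {set aug N k}) : R := f (orig S).

Definition aug_indep (I : {set {set N}}) : {set {set aug N k}} :=
  [set S | (orig S \in I) && (#|S| <= k)%N].

End Augmentation.

(* Main.v *)
(* For a base S that no deletion improves, let O be optimal and M the base
   chosen off S.  Posimodularity and f (S :\: O) <= f S give
   f (S :|: O) >= f O - f S; a base off S extending O :\: S by dummies shows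
   that the marginals of M sum to at least f (S :|: O) - f S, while the losses
   from removing single elements of S sum to at most f S.  As g pairs M with S,
   the k swaps together gain at least f O - 3 * f S, so the best one shrinks
   f O / 3 - f S by the factor 1 - 3 / k, which is nonnegative once k >= 3. *)
Require Import Defs.
From HB Require Import structures.
From mathcomp Require Import all_boot all_order all_algebra.
From mathcomp Require Import reals exp.
From mathcomp Require Import zify ring lra.
Set Implicit Arguments.
Unset Strict Implicit.
Unset Printing Implicit Defensive.
Import Order.TTheory GRing.Theory Num.Theory.
Local Open Scope ring_scope.

(** * Matroid bases: extension, symmetric exchange and exchange bijections *)

Section Matroid.
Variables (V : finType) (I : {set {set V}}).
Hypothesis matI : matroid I.

Lemma matroid_sub (A B : {set V}) : B \in I -> A \subset B -> A \in I.
Proof. by case: matI => _ + _; exact. Qed.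

(** Iterates the exchange axiom, by induction on the gap in size. The bound [C \subset A :|: B]
    later tells where the added elements come from. *)
Lemma matroid_extend (A B : {set V}) : A \in I -> B \in I -> (#|A| <= #|B|)%N ->
  exists C : {set V},
    [/\ C \in I, A \subset C, C \subset A :|: B & #|C| = #|B|].
Proof.
move=> AI BI; move dE: (#|B| - #|A|)%N => d.
elim: d => [|d IHd] in A AI dE *.
  move=> leAB; exists A; split; rewrite ?subsetUl //.
  by apply/eqP; rewrite eqn_leq leAB -subn_eq0 dE.
move=> leAB; have ltAB : (#|A| < #|B|)%N by rewrite -subn_gt0 dE.
have [x /setDP[xB xA] xAI] : exists2 x, x \in B :\: A & x |: A \in I.
  by case: matI => _ _; exact.
have [||C [CI sxAC sCAB cC]] := IHd _ xAI; rewrite ?cardsU1 ?xA //; first lia.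
exists C; split => //; first exact: subset_trans (subsetUr _ _) sxAC.
apply: subset_trans sCAB _; rewrite !subUset sub1set !inE xB orbT /=.
by rewrite subsetUl subsetUr.
Qed.

(** [B :\ u] lies in [S] and has one element fewer, so it misses exactly one v of [S]. *)
Lemma eq_swap_of_subU1 (S B : {set V}) u :
  u \notin S -> u \in B -> B \subset u |: S ->
  #|B| = #|S| -> exists2 v, v \in S & B = u |: (S :\ v).
Proof.
move=> uS uB sB cB.
have : (0 < #|S :\: B|)%N.
  have := cardsD1 u B; rewrite uB /= => cB1.
  have sBS : B :\ u \subset S by rewrite subDset.
  have : (#|B :\ u| < #|S|)%N by lia.
  have := cardsID B S; have := subset_leq_card sBS.
  have -> : S :&: B = B :\ u.
    apply/setP => x; rewrite !inE; have [->|xu] := eqVneq x u.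
      by rewrite (negPf uS).
    rewrite /= andbC; case xB: (x \in B) => //=.
    by have := subsetP sB x xB; rewrite !inE (negPf xu).
  by lia.
case/card_gt0P => v /setDP[vS vB]; exists v => //.
apply/eqP; rewrite eqEcard cardsU1 !inE (negPf uS) andbF /= cB.
rewrite (cardsD1 v S) vS leqnn andbT; apply/subsetP => x xB.
have := subsetP sB x xB; rewrite !inE; case: eqP => //= _ ->; rewrite andbT.
by apply: contraNneq vB => <-.
Qed.

(* The candidates v form the fundamental circuit of u minus u itself. *)
Lemma exchange_set_dep (S : {set V}) u : S \in I -> u \notin S ->
  u |: [set v in S | u |: (S :\ v) \in I] \in I -> u |: S \in I.
Proof.
set T := [set v in S | _] => SI uS uTI.
apply: contraT => uSI.
have sTS : T \subset S by apply/subsetP => v; rewrite inE => /andP[].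
have uT : u \notin T by apply: contraNN uS; exact/subsetP.
have ltTS : (#|T| < #|S|)%N.
  rewrite ltnNge; apply: contraNN uSI => leST.
  suff <- : T = S by [].
  by apply/eqP; rewrite eqEcard sTS.
(* Growing [u |: T] inside [u |: S] to size [#|S|] leaves out a single v of [S]. This v then
   qualifies for [T], although [T] was kept in [C]. *)
have [|C [CI sC sCU cC]] := matroid_extend uTI SI; first by rewrite cardsU1 uT.
have uC : u \in C by apply: (subsetP sC); rewrite setU11.
have [|v vS CE] := eq_swap_of_subU1 uS uC _ cC.
  by apply: subset_trans sCU _; rewrite -setUA (setUidPr sTS).
have vT : v \in T by rewrite inE vS -CE.
have : v \in C by apply: (subsetP sC); exact: setU1r.
rewrite CE !inE eqxx orbF => /eqP vu.
by rewrite -vu vS in uS.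
Qed.

Section Rank.
Variable k : nat.
Hypothesis rkI : matroid_rank I k.

Lemma indep_card (A : {set V}) : A \in I -> (#|A| <= k)%N.
Proof.
move=> AI; have [B Bmax sAB] := maxset_exists AI.
by rewrite -(rkI Bmax) subset_leq_card.
Qed.

Lemma base_card (B : {set V}) : base I B = (B \in I) && (#|B| == k).
Proof.
apply/idP/andP => [bB|[BI /eqP cB]].
  by rewrite (rkI bB) eqxx; case/maxsetP: bB.
apply/maxsetP; split=> // C CI sBC; apply/esym/eqP.
by rewrite eqEcard sBC cB indep_card.
Qed.

(** The set [T] of admissible partners spans u, so [M :\ u] together with [T] still has rank k.
    Hence some v in [T] completes [M :\ u] to a base, and membership in [T] is the swap on the side
    of [S]. *)
Lemma symmetric_exchange (M S : {set V}) u :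
  base I M -> base I S -> u \in M -> u \notin S ->
  exists v, [/\ v \in S, v \notin M, base I (u |: (S :\ v))
              & base I (v |: (M :\ u))].
Proof.
rewrite !base_card => /andP[MI /eqP cM] /andP[SI /eqP cS] uM uS.
pose T := [set v in S | u |: (S :\ v) \in I].
have sTS : T \subset S by apply/subsetP => v; rewrite inE => /andP[].
have uTI : u |: T \notin I.
  apply/negP => /(exchange_set_dep SI uS) /indep_card.
  by rewrite cardsU1 uS cS /= add1n ltnn.
have cM1 : k = (#|M :\ u|).+1 by rewrite -cM (cardsD1 u M) uM.
have M1I : M :\ u \in I by apply: matroid_sub MI _; exact: subsetDl.
have [C [CI sM1C sCT cC]] : exists C : {set V},
    [/\ C \in I, M :\ u \subset C, C \subset (M :\ u) :|: T & #|C| = k].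
  have TI := matroid_sub SI sTS.
  have [leT|ltT] := leqP #|T| #|M :\ u|.
    have [B [BI sTB sBU cB]] := matroid_extend TI M1I leT.
    have [x /setDP[xM xB] xBI] : exists2 x, x \in M :\: B & x |: B \in I.
      by case: matI => _ _; apply=> //; rewrite cB cM cM1.
    (* The dependence of [u |: T] enters here: since [T] lies in [B], adding u to [B] would make it
       independent. *)
    have xu : x != u.
      apply: contraNneq uTI => <-; apply: matroid_sub xBI _.
      exact: setUS.
    have [|C [CI sC sCU cC]] := matroid_extend M1I xBI.
      by rewrite cardsU1 xB cB leq_addl.
    exists C; split => //; last by rewrite cC cardsU1 xB cB cM1.
    apply: subset_trans sCU _; rewrite !subUset subsetUl sub1set !inE xu xM /=.
    by apply: subset_trans sBU _; rewrite setUC.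
  have [C [CI sC sCU cC]] := matroid_extend M1I TI (ltnW ltT).
  exists C; split => //; by apply/eqP; rewrite eqn_leq indep_card //= cC cM1.
have : (0 < #|C :\: (M :\ u)|)%N.
  by rewrite cardsD (setIidPr sM1C) cC cM1 subSnn.
case/card_gt0P => v /setDP[vC vM1].
have vT : v \in T by have := subsetP sCT v vC; rewrite inE (negPf vM1).
have vS := subsetP sTS v vT.
have vu : v != u by apply: contraNneq uS => <-.
have vM : v \notin M by move: vM1; rewrite !inE vu.
exists v; split; rewrite // base_card.
  move: vT; rewrite inE => /andP[_ ->] /=.
  by rewrite cardsU1 !inE (negPf uS) andbF -cS (cardsD1 v S) vS.
rewrite cardsU1 vM1 cM1 eqxx andbT; apply: matroid_sub CI _.
by rewrite subUset sub1set vC.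
Qed.

(* Exchanging one element of M for an element of S by [symmetric_exchange]
   brings M closer to S. *)
Lemma exchange_bijection (M S : {set V}) : base I M -> base I S ->
  exists g : V -> V, [/\ {in M, forall u, g u \in S}, {in M &, injective g},
      {in M :&: S, forall u, g u = u}
    & {in M, forall u, (u |: S) :\ g u \in I \/ u \in S}].
Proof.
move dE: #|M :\: S| => d; elim: d => [|d IHd] in M dE *.
  move=> bM bS; exists id; split => // u uM.
    suff /subsetP : M \subset S by exact.
    by rewrite -setD_eq0 -cards_eq0 dE.
  right; suff /subsetP : M \subset S by exact.
  by rewrite -setD_eq0 -cards_eq0 dE.
move=> bM bS.
have /card_gt0P[u /setDP[uM uS]] : (0 < #|M :\: S|)%N by rewrite dE.
have [v [vS vM bSv bMu]] := symmetric_exchange bM bS uM uS.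
pose M' := v |: (M :\ u).
have [|g [gS g_inj g_fix gI]] := IHd M' _ bMu bS.
  have -> : M' :\: S = (M :\: S) :\ u.
    apply/setP => x; rewrite !inE; case: eqP => [->|_] /=; last first.
      by case: (_ \in S); rewrite ?andbF.
    by rewrite vS (negPf vM) /= andbF.
  by move: dE; rewrite (cardsD1 u (M :\: S)) !inE uM uS => -[].
have vM' : v \in M' by rewrite setU11.
have inM' x : x \in M -> x != u -> x \in M'.
  by move=> xM xu; rewrite !inE xM xu orbT.
(* As v is in both [M'] and [S], the inductive map fixes it; no other element of [M] is sent to v,
   so sending u there keeps injectivity. *)
have gv : g v = v by apply: g_fix; rewrite inE vM' vS.
have vu : v != u by apply: contraNneq uS => <-.
have neq_v x : x \in M -> x != v by move=> xM; apply: contraNneq vM => <-.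
exists (fun x => if x == u then v else g x); split => /=.
- by move=> x xM; case: eqVneq => // xu; apply: gS; exact: inM'.
- move=> x y xM yM; case: eqVneq => [->|xu]; case: eqVneq => [->|yu] //.
  + rewrite -gv => /g_inj E; have := neq_v y yM.
    by rewrite -E ?eqxx //; exact: inM'.
  + rewrite -gv => /g_inj E; have := neq_v x xM.
    by rewrite E ?eqxx //; exact: inM'.
  + by apply: g_inj; exact: inM'.
- move=> x /setIP[xM xS]; case: eqVneq => [xu|xu].
    by rewrite -xu xS in uS.
  by apply: g_fix; rewrite inE xS inM'.
- move=> x xM; case: eqVneq => [->|xu]; last by apply: gI; exact: inM'.
  left; suff -> : (u |: S) :\ v = u |: (S :\ v).
    by move: bSv; rewrite base_card => /andP[].
  apply/setP => y; rewrite !inE; case: (eqVneq y u) => [->|_] //=.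
  by rewrite eq_sym vu.
Qed.

End Rank.
End Matroid.

(** * Inequalities for submodular and symmetric functions *)

Section Submodular.
Variables (R : realType) (V : finType) (F : {set V} -> R).
Hypothesis subF : submodular F.

(** Diminishing returns, adding [T] one element at a time; elements already in [S] contribute
    zero. *)
Lemma submodular_sum (S T : {set V}) :
  F (S :|: T) - F S <= \sum_(u in T) (F (u |: S) - F S).
Proof.
move cT: #|T| => n; elim: n => [|n IHn] in T cT *.
  by move/eqP: cT; rewrite cards_eq0 => /eqP ->; rewrite setU0 subrr big_set0.
have /card_gt0P[u uT] : (0 < #|T|)%N by rewrite cT.
rewrite (big_setD1 u) //=.
have /IHn : #|T :\ u| = n by move: cT; rewrite (cardsD1 u) uT => -[].
have [uS|uS] := boolP (u \in S).
  have -> : S :|: T :\ u = S :|: T.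
    by apply/setP => x; rewrite !inE; case: eqP => [->|]; rewrite ?uS.
  by have -> : u |: S = S; [apply/setUidPr; rewrite sub1set|lra].
have := subF (u |: S) (S :|: T :\ u).
have -> : (u |: S) :|: (S :|: T :\ u) = S :|: T.
  apply/setP => x; rewrite !inE.
  by case: eqP => [->|]; rewrite ?uT ?orbT //= orbA orbb.
have -> : (u |: S) :&: (S :|: T :\ u) = S.
  apply/setP => x; rewrite !inE; case: eqP => [->|] /=.
    by rewrite (negPf uS).
  by move=> _; case: (x \in S).
lra.
Qed.

(** The local optimality that [delete] leaves behind, and the invariant carried between
    iterations. *)
Definition deletion_stable (S : {set V}) := {in S, forall v, F (S :\ v) <= F S}.

Hypothesis symF : symmetric_setfun F.

(** By symmetry, deleting from [S] is adding to [~: S], so this is [submodular_sum] at the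
    complement. *)
Lemma symmetric_submodular_sum (S A : {set V}) :
  F (S :\: A) - F S <= \sum_(v in A) (F (S :\ v) - F S).
Proof.
have E (B : {set V}) : F (S :\: B) = F (~: S :|: B).
  by rewrite symF setDE setCI setCK.
rewrite E [in leLHS](symF S); apply: le_trans (submodular_sum _ _) _.
by apply: ler_sum => v _; rewrite E setUC -symF.
Qed.

(** Removing [S :\: A] at once gains at most the sum of the single deletions, each of which gains
    nothing. *)
Lemma deletion_stable_sub (S A : {set V}) :
  deletion_stable S -> A \subset S -> F A <= F S.
Proof.
move=> stS sAS; have := symmetric_submodular_sum S (S :\: A).
rewrite setDDr setDv set0U (setIidPr sAS) => h.
rewrite -subr_le0; apply: le_trans h _; apply: sumr_le0 => v /setDP[vS _].
by rewrite subr_le0 stS.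
Qed.

Hypothesis F_ge0 : forall S, 0 <= F S.

(* Posimodularity applied to S :|: O and S :\: O. *)
Lemma deletion_stable_union (S O : {set V}) :
  deletion_stable S -> F O - F S <= F (S :|: O) - F set0.
Proof.
move=> stS; have := deletion_stable_sub stS (subsetDl S O).
have := subF (S :|: O) (~: (S :\: O)); rewrite -symF.
have -> : (S :|: O) :|: ~: (S :\: O) = setT.
  by apply/setP => x; rewrite !inE; case: (_ \in S); case: (_ \in O).
have -> : (S :|: O) :&: ~: (S :\: O) = O.
  by apply/setP => x; rewrite !inE; case: (_ \in S); case: (_ \in O).
by rewrite [F setT]symF setCT; lra.
Qed.

(** By submodularity each swap gains at least its addition plus its deletion. The additions total at
    least [F O - 2 * F S + F set0]; the deletions run once over [S] through g and total at least
    [F set0 - F S]. *)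
Lemma swap_sum (S M O : {set V}) (g : V -> V) : deletion_stable S ->
  M \subset ~: S -> {in M &, injective g} -> g @: M = S ->
  F (S :|: O) - F S <= \sum_(u in M) (F (u |: S) - F S) ->
  F O - 3 * F S <= \sum_(u in M) (F ((u |: S) :\ g u) - F S).
Proof.
move=> stS /subsetP sMS g_inj gM hO.
have := symmetric_submodular_sum S S; rewrite setDv -{2}gM big_imset //= => hS.
have := deletion_stable_union O stS.
suff : \sum_(u in M) (F (u |: S) - F S) + \sum_(u in M) (F (S :\ g u) - F S)
    <= \sum_(u in M) (F ((u |: S) :\ g u) - F S).
  have := F_ge0 set0; lra.
rewrite -big_split /=; apply: ler_sum => u uM.
have uS : u \notin S by have := sMS u uM; rewrite inE.
have guS : g u \in S by rewrite -gM imset_f.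
have := subF ((u |: S) :\ g u) S.
have -> : ((u |: S) :\ g u) :|: S = u |: S.
  apply/setP => x; rewrite !inE.
  by case: (eqVneq x (g u)) => [->|_]; rewrite ?guS ?orbT //= -orbA orbb.
have -> : ((u |: S) :\ g u) :&: S = S :\ g u.
  apply/setP => x; rewrite !inE; case: eqP => //= _.
  by case: (x \in S); rewrite ?orbT ?andbF.
lra.
Qed.

End Submodular.

(** * Reasoning rules for oracle computations, and the deletion pass *)

Section Runs.
Variables (R : realType) (V : finType) (F : {set V} -> R).

Lemma every_run_bind (A B : Type) (p : prog R V A) (c : A -> prog R V B) q Q :
  every_run F p q (fun q' a => every_run F (c a) q' Q) ->
  every_run F (bind p c) q Q.
Proof.
elim: p q => [a|T d IHd|C P d IHd] q //=; first exact: IHd.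
by case=> exP runP; split=> // b /runP; exact: IHd.
Qed.

Lemma every_run_weaken (A : Type) (p : prog R V A) q (Q Q' : nat -> A -> Prop) :
  (forall q a, Q q a -> Q' q a) -> every_run F p q Q -> every_run F p q Q'.
Proof.
move=> sQ; elim: p q => [a|T d IHd|C P d IHd] q //=; first exact: sQ.
  exact: IHd.
by case=> exP runP; split=> // b /runP; exact: IHd.
Qed.

Lemma every_run_tabulate (T : V -> {set V}) (S : {set V}) s q
    (Q : nat -> (V -> R) -> Prop) :
  (forall w, {in s, forall u, w u = F (T u) - F S} -> Q (q + 2 * size s)%N w) ->
  every_run F (tabulate (fun u => gain R (T u) S) s) q Q.
Proof.
elim: s q Q => [|u s IHs] q Q hQ /=; first by rewrite -[q]addn0; apply: hQ.
apply/every_run_bind/IHs => w hw /=.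
have -> : (q.+2 + 2 * size s = q + 2 * size (u :: s))%N by rewrite /=; lia.
apply: hQ => v; rewrite inE; case: eqVneq => [->|_] //=; exact: hw.
Qed.

Hypotheses (subF : submodular F) (symF : symmetric_setfun F).

(** Invariant: elements already visited and kept cannot be deleted with profit. Later deletions
    preserve this, so one pass in any order reaches stability, without ever lowering [F]. *)
Lemma every_run_delete_loop s (S : {set V}) q (Q : nat -> {set V} -> Prop) :
  uniq s -> {subset s <= S} ->
  {in S, forall v, v \notin s -> F (S :\ v) <= F S} ->
  (forall S' : {set V}, S' \subset S -> F S <= F S' -> deletion_stable F S' ->
    Q (q + 2 * size s)%N S') ->
  every_run F (delete_loop R s S) q Q.
Proof.
elim: s S q => [|u s IHs] S q /=.
  by move=> _ _ stS; rewrite muln0 addn0; apply=> // v vS; exact: stS.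
move=> /andP[us uniqs] sS stS hQ.
have uS : u \in S by apply: sS; rewrite mem_head.
have sS' v : v \in s -> v \in S by move=> vs; apply: sS; rewrite inE vs orbT.
have q2 : (q.+2 + 2 * size s = q + 2 * (size s).+1)%N by lia.
rewrite setD1K //; case: ltP; rewrite ?(subr_lt0, subr_ge0) => hu.
  apply: IHs => // [v vs|v /setD1P[vu vS] vs|S' sS'' le' stS'].
  - by rewrite !inE sS' // andbT; apply: contraNneq us => <-.
  - have := stS v vS; rewrite inE (negPf vu) => /(_ vs).
    (* Removing v after u gains no more than removing v from [S], hence nothing. *)
    have := subF (S :\ u) (S :\ v).
    have -> : (S :\ u) :|: (S :\ v) = S.
      apply/setP => x; rewrite !inE; case: (eqVneq x u) => [->|] /=.
        by rewrite eq_sym vu.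
      by case: (x \in S); rewrite ?andbF.
    have -> : (S :\ u) :&: (S :\ v) = S :\ u :\ v.
      apply/setP => x; rewrite !inE.
      by case: (x \in S); rewrite ?andbF ?andbT // andbC.
    lra.
  - rewrite q2; apply: hQ => //; first exact: subset_trans sS'' (subsetDl _ _).
    exact: le_trans (ltW hu) le'.
apply: IHs => // [v vS vs|S' sS'' le' stS']; last by rewrite q2; exact: hQ.
by have [->//|vu] := eqVneq v u; apply: stS; rewrite // inE negb_or vu.
Qed.

Lemma every_run_delete (S : {set V}) q (Q : nat -> {set V} -> Prop) :
  (forall S' : {set V}, S' \subset S -> F S <= F S' -> deletion_stable F S' ->
    Q (q + 2 * #|S|)%N S') ->
  every_run F (delete R S) q Q.
Proof.
move=> hQ; split=> [|s pS]; first by exists (enum S).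
have sS : s =i S by move=> x; rewrite (perm_mem pS) mem_enum.
apply: every_run_delete_loop.
- by rewrite (perm_uniq pS) enum_uniq.
- by move=> x; rewrite sS.
- by move=> v vS; rewrite sS vS.
- by rewrite (perm_size pS) -cardE.
Qed.

End Runs.

(** * One greedy iteration and its repetition *)

Section Iteration.
Variables (R : realType) (V : finType) (F : {set V} -> R).
Variables (D : {set V}) (I : {set {set V}}) (k : nat).
Hypotheses (F_ge0 : forall S, 0 <= F S).
Hypotheses (subF : submodular F) (symF : symmetric_setfun F).
Hypothesis FD : forall S, F (S :\: D) = F S.
Hypotheses (matI : matroid I) (rkI : matroid_rank I k).
Hypothesis dummyI : forall C : {set V}, C \subset D -> (#|C| <= k)%N -> C \in I.
Hypothesis cardD : #|D| = (2 * k)%N.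

Lemma eq_off_dummies (S T : {set V}) : S :\: D = T :\: D -> F S = F T.
Proof. by move=> E; rewrite -FD E FD. Qed.

(** Of the 2k dummies at least k avoid [X]; any k of these are independent, and [A] is extended
    towards them. *)
Lemma dummy_completion (A X : {set V}) : A \in I -> (#|X| <= k)%N ->
  exists B : {set V}, [/\ base I B, A \subset B & B :\: A \subset D :\: X].
Proof.
move=> AI cX.
have [C sC cC] : exists2 C : {set V}, C \subset D :\: X & #|C| = k.
  have : (0 < #|[set C : {set V} | C \subset D :\: X & #|C| == k]|)%N.
    rewrite cards_draws bin_gt0; have := subset_leq_card (subsetIr D X).
    by rewrite cardsD cardD; lia.
  by case/card_gt0P => C; rewrite inE => /andP[sC /eqP cC]; exists C.
have CI : C \in I by apply: dummyI; rewrite ?cC // (subset_trans sC) ?subsetDl.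
have [|B [BI sAB sB cB]] := matroid_extend matI AI CI.
  by rewrite cC (indep_card rkI).
exists B; split=> //; first by rewrite (base_card rkI) BI cB cC eqxx.
by rewrite subDset (subset_trans sB) ?setUS.
Qed.

(** Deleting a dummy leaves [F] unchanged; deleting any other element acts as it does on [S']. *)
Lemma dummy_completion_stable (S S' : {set V}) : deletion_stable F S' ->
  S' \subset S -> S :\: S' \subset D -> F S = F S' /\ deletion_stable F S.
Proof.
move=> stS' sS /subsetP sD.
have SD : S :\: D = S' :\: D.
  apply/setP => x; rewrite !inE; case: (boolP (x \in D)) => //= xD.
  apply/idP/idP => [xS|]; last exact: (subsetP sS).
  by apply: contraNT xD => xS'; apply: sD; rewrite !inE xS'.
have FS := eq_off_dummies SD; split=> // v vS.
have [vD|vD] := boolP (v \in D).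
  rewrite (@eq_off_dummies (S :\ v) S) //; apply/setP => x; rewrite !inE.
  by case: (eqVneq x v) => [->|]; rewrite ?vD.
have vS' : v \in S' by apply: contraNT vD => vS'; apply: sD; rewrite !inE vS'.
rewrite FS (@eq_off_dummies (S :\ v) (S' :\ v)); first exact: stS'.
by rewrite !setDDl setUC -!setDDl SD.
Qed.

(** Besides the gain, every choice must be shown possible: S by padding, M by dummies off S, g by
    [exchange_bijection], and u because [0 < k] makes M nonempty. *)
Lemma every_run_greedy_step (O S' : {set V}) q (Q : nat -> {set V} -> Prop) :
  (0 < k)%N -> O \in I -> S' \in I -> deletion_stable F S' ->
  (forall q' (T : {set V}), (q' <= q + 2 * #|V| + 2 * k)%N ->
     T \in I -> deletion_stable F T ->
     F S' + (F O - 3 * F S') / k%:R <= F T -> Q q' T) ->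
  every_run F (greedy_step R D I S') q Q.
Proof.
move=> k0 OI S'I stS' hQ; split=> /= [|S [bS sS sD]].
  have [|B [bB sB sBD]] := dummy_completion S'I (X := set0); rewrite ?cards0 //.
  by exists B; split=> //; rewrite setD0 in sBD.
have [FS stS] := dummy_completion_stable stS' sS sD.
have /andP[SI /eqP cS] : (S \in I) && (#|S| == k) by rewrite -base_card.
have cSk : (#|S| <= k)%N by rewrite cS.
apply/every_run_bind/every_run_tabulate => w hw /=; split.
  have I0 : set0 \in I by case: matI.
  have [B [bB _ sB]] := dummy_completion I0 cSk.
  have sBS : B \subset ~: S.
    by rewrite setD0 in sB; apply: subset_trans sB _; rewrite setDE subsetIr.
  pose P (M : {set V}) := base I M && (M \subset ~: S).
  have PB : P B by rewrite /P bB.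
  case: (arg_maxP (fun M : {set V} => \sum_(u in M) w u) PB).
  move=> M /andP[bM sM] maxM.
  by exists M; split=> // M' bM' sM'; apply: maxM; rewrite /P bM'.
move=> M [bM sMS maxM].
have /andP[MI /eqP cM] : (M \in I) && (#|M| == k) by rewrite -base_card.
have wE (u : V) : u \in ~: S -> w u = F (u |: S) - F S.
  by move=> uS; apply: hw; rewrite mem_enum.
have uniS u : u \in M -> u \notin S by move/(subsetP sMS); rewrite inE.
split.
  have [g [gS g_inj gfix gI]] := exchange_bijection matI rkI bM bS.
  exists g; split=> // u uM; case: (gI u uM) => // uS.
  by have := uniS u uM; rewrite uS.
move=> g [gS g_inj _ gI].
(* Surjectivity lets the deletions made by the swaps cover all of [S]. *)
have gM : g @: M = S.
  apply/eqP; rewrite eqEcard card_in_imset // cM cS leqnn andbT.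
  by apply/subsetP => _ /imsetP[u uM ->]; exact: gS.
apply/every_run_bind/every_run_tabulate => v hv /=.
have vE (u : V) : u \in M -> v u = F ((u |: S) :\ g u) - F S.
  by move=> uM; apply: hv; rewrite mem_enum.
split.
  have /card_gt0P[u0 u0M] : (0 < #|M|)%N by rewrite cM.
  by case: (arg_maxP v u0M) => u uM maxu; exists u.
move=> u [uM maxu]; apply: every_run_delete => // T sT leT stT.
(* Queries: [2 * #|~: S|] for w, 2k for v and 2k for the deletion pass; the first two make
   [2 * #|V|]. *)
have cV : #|V| = (#|~: S| + k)%N by rewrite -(cardsC S) cS addnC.
have cT : #|(u |: S) :\ g u| = k.
  have := cardsD1 (g u) (u |: S).
  by rewrite cardsU1 (uniS u uM) cS setU1r ?gS // => -[].
apply: hQ => //; first by rewrite -!cardE cM cT cV mulnDr !addnA.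
  exact: matroid_sub (gI u uM) sT.
apply: le_trans leT.
(* [B] competes with [M] in the choice of a base off [S], and agrees with [O] outside [S] up to
   dummies. *)
have [B [bB sB sBD]] : exists B : {set V},
    [/\ base I B, O :\: S \subset B & B :\: (O :\: S) \subset D :\: S].
  by apply: dummy_completion; rewrite // (matroid_sub matI OI) ?subsetDl.
have sBS : B \subset ~: S.
  apply/subsetP => x xB; rewrite inE; apply/negP => xS.
  by have /(subsetP sBD) : x \in B :\: (O :\: S); rewrite !inE xS ?xB.
have FB : F (S :|: B) = F (S :|: O).
  apply: eq_off_dummies; apply/setP => x; rewrite !inE.
  case: (boolP (x \in D)) => //= xD; case: (boolP (x \in S)) => //= xS.
  apply/idP/idP => [xB|xO]; last by apply: (subsetP sB); rewrite !inE xS.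
  apply: contraNT xD => xO; have /(subsetP sBD) : x \in B :\: (O :\: S).
    by rewrite !inE xB (negPf xO) andbF.
  by rewrite inE => /andP[].
have hO : F (S :|: O) - F S <= \sum_(u in M) (F (u |: S) - F S).
  rewrite -FB; apply: le_trans (submodular_sum subF _ _) _.
  rewrite (eq_bigr w) => [|x xB]; last by rewrite wE // (subsetP sBS).
  rewrite [leRHS](eq_bigr w) => [|x xM]; last by rewrite wE // (subsetP sMS).
  exact: maxM.
have := swap_sum subF symF F_ge0 stS sMS g_inj gM hO.
(* The best of the k swaps is at least their average. *)
have : \sum_(x in M) (F ((x |: S) :\ g x) - F S)
    <= k%:R * (F ((u |: S) :\ g u) - F S).
  rewrite mulr_natl -cM -sumr_const; apply: ler_sum => x xM.
  by rewrite -!vE //; exact: maxu.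
rewrite -FS => le1 le2; rewrite -lerBrDl ler_pdivrMr ?ltr0n // [leRHS]mulrC.
exact: le_trans le2 le1.
Qed.

(** Chaining the step bounds multiplies an inequality by [1 - 3 / k%:R], hence the guard [2 < k] on
    the value bound; feasibility and the query count carry no such guard. *)
Lemma every_run_greedy_iter (O S : {set V}) K q (Q : nat -> {set V} -> Prop) :
  (0 < K -> 0 < k)%N -> O \in I -> S \in I -> deletion_stable F S ->
  (forall q' (T : {set V}), (q' <= q + K * (2 * #|V| + 2 * k))%N -> T \in I ->
     ((2 < k)%N -> F O / 3 - F T <= (1 - 3 / k%:R) ^+ K * (F O / 3 - F S)) ->
     Q q' T) ->
  every_run F (greedy_iter R D I K S) q Q.
Proof.
move=> + OI; elim: K S q => [|K IHK] S q K0 SI stS hQ.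
  by apply: hQ; rewrite ?leq_addr // expr0 mul1r.
have k0 := K0 isT.
apply: (every_run_bind (p := greedy_step R D I S)).
apply: (every_run_greedy_step k0 OI SI stS) => q' T hq' TI stT hT.
apply: IHK => // q'' U hq'' UI hU; apply: hQ => //.
  by apply: leq_trans hq'' _; rewrite (mulSn K) [leqRHS]addnA leq_add2r addnA.
move=> k2; apply: le_trans (hU k2) _.
have kR : (3 : R) <= k%:R by rewrite ler_nat.
have r0 : 0 <= 1 - 3 / k%:R :> R.
  by rewrite subr_ge0 ler_pdivrMr ?mul1r // ltr0n.
rewrite exprSr -mulrA; apply: ler_wpM2l; first exact: exprn_ge0.
have -> : (1 - 3 / k%:R) * (F O / 3 - F S)
    = F O / 3 - (F S + (F O - 3 * F S) / k%:R).
  by field; rewrite pnatr_eq0 -lt0n.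
by rewrite lerD2l lerN2.
Qed.

End Iteration.

(** * The instance augmented with dummies *)

Section Augmented.
Variables (N : finType) (I : {set {set N}}) (k : nat).
Hypotheses (matI : matroid I) (rkI : matroid_rank I k).

Lemma card_aug (S : {set aug N k}) :
  #|S| = (#|orig S| + #|[set d | inr d \in S]|)%N.
Proof.
rewrite -!sum1_card big_sumType /=.
by congr (_ + _)%N; apply: eq_bigl => x; rewrite inE.
Qed.

Lemma card_dummies : #|dummies N k| = (2 * k)%N.
Proof. by rewrite card_imset ?card_ord // => x y []. Qed.

Lemma mem_dummies (x : aug N k) :
  (x \in dummies N k) = if x is inr _ then true else false.
Proof.
by apply/imsetP/idP => [[d _ ->]|] //; case: x => // d _; exists d.
Qed.

Lemma aug_indepE (S : {set aug N k}) :
  (S \in aug_indep k I) = (orig S \in I) && (#|S| <= k)%N.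
Proof. by rewrite inE. Qed.

Lemma aug_matroid : matroid (aug_indep k I).
Proof.
have [I0 Isub Iexch] := matI; split.
- rewrite aug_indepE cards0 andbT (_ : orig _ = set0) //.
  by apply/setP => x; rewrite !inE.
- move=> A B; rewrite !aug_indepE => /andP[BI cB] sAB.
  rewrite (leq_trans (subset_leq_card sAB)) // andbT (Isub _ _ BI) //.
  by apply/subsetP => x; rewrite !inE; exact: (subsetP sAB).
move=> A B; rewrite !aug_indepE => /andP[AI cA] /andP[BI cB] cAB.
have cU x : x \notin A -> (#|x |: A| <= k)%N.
  by move=> xA; rewrite cardsU1 xA (leq_trans cAB).
(* If [A] contains all dummies of [B], the size gap lies in the original parts and exchange in [I]
   applies; otherwise a missing dummy can be added freely. *)
have [sd|/subsetPn[d]] :=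
    boolP ([set d | inr d \in B] \subset [set d | inr d \in A]).
  have lt : (#|orig A| < #|orig B|)%N.
    rewrite -(ltn_add2r #|[set d | inr d \in A]|) -card_aug.
    by rewrite (leq_trans cAB) // card_aug leq_add2l subset_leq_card.
  have [x] := Iexch _ _ AI BI lt; rewrite !inE => /andP[xA xB] xAI.
  exists (inl x); first by rewrite inE xA.
  rewrite aug_indepE cU // andbT (_ : orig _ = x |: orig A) //.
  by apply/setP => y; rewrite !inE.
rewrite !inE => dB dA; exists (inr d); first by rewrite inE dA.
rewrite aug_indepE cU // andbT (_ : orig _ = orig A) //.
by apply/setP => y; rewrite !inE.
Qed.

Lemma aug_dummies_indep (C : {set aug N k}) :
  C \subset dummies N k -> (#|C| <= k)%N -> C \in aug_indep k I.
Proof.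
move=> sC cC; rewrite aug_indepE cC andbT (_ : orig C = set0).
  by case: matI.
apply/setP => x; rewrite !inE; apply/negP => /(subsetP sC).
by rewrite mem_dummies.
Qed.

(** A maximal set with fewer than k elements could still take a dummy from an independent k-set of
    dummies. *)
Lemma aug_rank : matroid_rank (aug_indep k I) k.
Proof.
move=> B bB; have /maxsetP[BI maxB] := bB.
have cB : (#|B| <= k)%N by move: BI; rewrite aug_indepE => /andP[].
apply/eqP; rewrite eqn_leq cB leqNgt; apply/negP => ltB.
have : (0 < #|[set C : {set aug N k} | C \subset dummies N k & #|C| == k]|)%N.
  by rewrite cards_draws bin_gt0 card_dummies leq_pmull.
case/card_gt0P => C; rewrite inE => /andP[sC /eqP cC].
have [_ _ exch] := aug_matroid.
have [||x /setDP[xC xB] xI] := exch B C BI;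
  rewrite ?cC ?aug_dummies_indep ?cC //.
by have := maxB _ xI (subsetUr _ _) => E; rewrite -E setU11 in xB.
Qed.

Variables (R : realType) (f : {set N} -> R).
Hypotheses (symf : symmetric_setfun f) (subf : submodular f).

Lemma aug_symmetric : symmetric_setfun (aug_fun f : {set aug N k} -> R).
Proof.
move=> S; rewrite /aug_fun symf; congr f.
by apply/setP => x; rewrite !inE.
Qed.

Lemma aug_submodular : submodular (aug_fun f : {set aug N k} -> R).
Proof.
move=> S T; rewrite /aug_fun; have := subf (orig S) (orig T).
have -> : orig S :|: orig T = orig (S :|: T) by apply/setP => x; rewrite !inE.
suff -> : orig S :&: orig T = orig (S :&: T) by [].
by apply/setP => x; rewrite !inE.
Qed.

Lemma aug_fun_setD_dummies (S : {set aug N k}) :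
  aug_fun f (S :\: dummies N k) = aug_fun f S.
Proof.
congr f; apply/setP => x.
by rewrite inE in_setD mem_dummies /= inE.
Qed.

Lemma aug_opt : exists2 O, O \in aug_indep k I & opt f I = aug_fun f O.
Proof.
have [I0 _ _] := matI; rewrite /opt; case: arg_maxP => // O OI _.
have E : orig (inl @: O : {set aug N k}) = O.
  by apply/setP => x; rewrite inE mem_imset // => ? ? [].
exists (inl @: O); last by rewrite /aug_fun E.
by rewrite aug_indepE E OI (leq_trans (leq_imset_card _ _)) // (indep_card rkI).
Qed.

End Augmented.

(** * Numerical estimates for the contraction and the query count *)

Section Estimates.
Variable R : realType.

Lemma natr_absz_ceil (x : R) : 0 <= x -> x <= (`|Num.ceil x|%N)%:R <= x + 1.
Proof.
move=> x0; have c0 : 0 <= Num.ceil x.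
  by rewrite ceil_ge0 (lt_le_trans _ x0) // ltrN10.
rewrite natr_absz ger0_norm // ceil_ge /=.
by have := ceilB1_lt x; rewrite intrB; lra.
Qed.

(** From [1 - c <= expR (- c)], raised to the power K. *)
Lemma contraction_pow_le (eps c : R) K : 0 < eps -> 0 <= 1 - c ->
  ln eps^-1 <= K%:R * c -> (1 - c) ^+ K <= eps.
Proof.
move=> e0 c1 hK; have := expR_ge1Dx (- c) => hc.
apply: le_trans (lerXn2r K _ _ hc) _; rewrite ?nnegrE ?expR_ge0 //.
rewrite -expRM_natl -[leRHS]lnK ?posrE // ler_expR.
by rewrite lnV ?posrE // in hK; rewrite mulrN lerNl.
Qed.

(** Here x stands for the number of iterations and 8n for the queries in each. The extra 1 from
    rounding up is absorbed by [k * ln n / ln 2], which is at least 1 since [n >= 2]; this is the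
    source of [8 / ln 2]. *)
Lemma query_bound (n k : nat) (eps x : R) : (1 < n)%N -> (0 < k)%N ->
  0 < eps < 1 -> x <= k%:R / 3 * ln eps^-1 + 1 ->
  x * (8 * n%:R) <= (8 + 8 / ln 2) * (k%:R * n%:R * ln (n%:R / eps)).
Proof.
move=> n1 k1 /andP[e0 e1] hx.
have n0 : 0 < n%:R :> R by rewrite ltr0n ltnW.
have -> : ln (n%:R / eps) = ln n%:R + ln eps^-1 by rewrite lnM ?posrE ?invr_gt0.
move: hx; set L := ln eps^-1; set a := ln n%:R; set b := ln 2 => hx.
have L0 : 0 <= L by rewrite ln_ge0 // invf_ge1 // ltW.
have b0 : 0 < b by rewrite ln_gt0 // ltr1n.
have ba : b <= a by rewrite ler_ln ?posrE // ler_nat.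
have kR : 1 <= k%:R :> R by rewrite ler1n.
have kL : 0 <= k%:R * L by rewrite mulr_ge0.
have ka : 0 <= k%:R * a by rewrite mulr_ge0 // (le_trans (ltW b0)).
have kLb : 0 <= k%:R * L / b by rewrite divr_ge0 // ltW.
have kab : 1 <= k%:R * a / b.
  rewrite ler_pdivlMr // mul1r (le_trans ba) // ler_peMl //.
  exact: le_trans (ltW b0) ba.
have -> : (8 + 8 / b) * (k%:R * n%:R * (a + L))
    = (k%:R * a + k%:R * L + k%:R * a / b + k%:R * L / b) * (8 * n%:R).
  by field; exact: lt0r_neq0.
by rewrite ler_pM2r ?mulr_gt0 //; lra.
Qed.

End Estimates.

(** * Feasibility, approximation ratio and query bound of the algorithm *)

Theorem theorem3 (R : realType) :
  exists C : R,
  forall (N : finType) (f : {set N} -> R) (I : {set {set N}}) (k : nat)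
         (eps : R),
    (forall S : {set N}, 0 <= f S) ->
    symmetric_setfun f ->
    submodular f ->
    matroid I ->
    matroid_rank I k ->
    0 < eps < 1 ->
    every_run (aug_fun f)
      (greedy_matroid (dummies N k) (aug_indep k I) k eps) 0
      (fun (queries : nat) (S : {set aug N k}) =>
        [/\ S \in aug_indep k I /\ orig S \in I,
            (* fails for ranks 1 and 2: once S_i is good, swaps are still forced *)
            k \notin [:: 1%N; 2%N] ->
              (1 - eps) / 3 * opt f I <= f (orig S)
          & (* for n = k = 1 the bound tends to 0 as eps tends to 1 *)
            (1 < #|N|)%N ->
              queries%:R <= C * (k%:R * #|N|%:R * ln (#|N|%:R / eps))]).
Proof.
exists (8 + 8 / ln 2) => N f I k eps f0 symf subf matI rkI e01.
have /andP[e0 e1] := e01.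
have matA := aug_matroid k matI.
have rkA : matroid_rank (aug_indep k I) k := aug_rank matI.
have symF : symmetric_setfun (aug_fun f : {set aug N k} -> R) :=
  aug_symmetric symf.
have subF : submodular (aug_fun f : {set aug N k} -> R) := aug_submodular subf.
have FD := aug_fun_setD_dummies (k := k) f.
have dumA := aug_dummies_indep (k := k) matI.
have cD := card_dummies N k.
have F0 (S : {set aug N k}) : 0 <= aug_fun f S by exact: f0.
have [O OA optE] := aug_opt matI rkI f.
have AI (S : {set aug N k}) : S \in aug_indep k I -> orig S \in I.
  by rewrite aug_indepE => /andP[].
have kn : (k <= #|N|)%N.
  have [B bB _] := maxset_exists (let: And3 I0 _ _ := matI in I0).
  by rewrite -(rkI _ bB) max_card.
set x := k%:R / 3 * ln eps^-1; have x0 : 0 <= x.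
  by rewrite mulr_ge0 ?divr_ge0 ?ler0n // ln_ge0 // invf_ge1 // ltW.
have /andP[xK Kx] := natr_absz_ceil x0.
(* For rank 0 no iteration is run. *)
have K0 : (0 < `|Num.ceil x| -> 0 < k)%N.
  by rewrite !lt0n; apply: contraNneq => k0; rewrite /x k0 !mul0r ceil0.
have A0 : set0 \in aug_indep k I by case: matA.
split=> [|S0 [bS0 sS0]].
  have [|B [bB _ sB]] := dummy_completion matA rkA dumA cD A0 (X := set0).
    by rewrite cards0.
  by exists B; split=> //; rewrite !setD0 in sB.
(* Consisting of dummies, [S0] is a padding of the empty set, which is vacuously stable. *)
have stS0 : deletion_stable (aug_fun f : {set aug N k} -> R) S0.
  have st0 : deletion_stable (aug_fun f : {set aug N k} -> R) set0.
    by move=> v; rewrite inE.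
  by have [] := dummy_completion_stable FD st0 (sub0set S0); rewrite ?setD0.
have S0A : S0 \in aug_indep k I by case/maxsetP: bS0.
apply: (every_run_greedy_iter F0 subF symF FD matA rkA dumA cD K0 OA S0A stS0).
move=> q T hq TA hT; split=> [|k12|N1]; first by split=> //; exact: AI.
  have O0 := F0 O; change (f (orig T)) with (aug_fun f T); rewrite optE.
  have [k0|k2] : k = 0%N \/ (2 < k)%N.
    by move: k12; case: (k) => [|[|[|?]]]; auto.
    (* In rank 0 the empty set is the only feasible one, hence optimal. *)
    have aug0 (S : {set aug N k}) : S \in aug_indep k I -> S = set0.
      move/(indep_card rkA) => leS; apply/eqP.
      by rewrite -cards_eq0 -leqn0 (leq_trans leS) // k0.
    by rewrite (aug0 T TA) -(aug0 O OA) ler_piMl //; move: e0; clear; lra.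
  have kR : 3 <= k%:R :> R by rewrite ler_nat.
  have r0 : 0 <= 1 - 3 / k%:R :> R.
    by rewrite subr_ge0 ler_pdivrMr ?mul1r // (lt_le_trans _ kR).
  have := hT k2; set r := _ ^+ _ => hr.
  have re : r <= eps.
    apply: contraction_pow_le => //.
    apply: le_trans (ler_wpM2r _ xK); last by rewrite divr_ge0.
    rewrite /x (_ : k%:R / 3 * _ * _ = ln eps^-1) //.
    by field; rewrite pnatr_eq0 -lt0n (ltn_trans _ k2).
  (* Dropping the starting value leaves [F T >= (1 - r) * F O / 3]. *)
  have rS : 0 <= r * aug_fun f S0 by rewrite mulr_ge0 // exprn_ge0.
  by have := ler_wpM2r O0 re; move: hr rS; clear; lra.
have [k0|k0] := posnP k.
  have K00 : `|Num.ceil x|%N = 0%N.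
    by apply/eqP; rewrite -leqn0 leqNgt; apply/negP => /K0; rewrite k0.
  by move: hq; rewrite K00 mul0n leqn0 => /eqP ->; rewrite k0 !mul0r mulr0.
apply: le_trans (query_bound N1 k0 e01 Kx).
rewrite -!natrM ler_nat (leq_trans hq) // add0n leq_mul2l; apply/orP; right.
(* With n + 2k elements an iteration costs at most 2(n + 2k) + 2k queries, which is at most 8n as k
   is at most n. *)
by rewrite card_sum card_ord; move: kn; clear; lia.
Qed.
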